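(* Let $k\ge 2$ and let $\mathcal{T}$ be a $k$-tree. Then every zero (in $\mathbb{C}$) of the matching polynomial $\mu(\mathcal{T},x)$ is an eigenvalue of the adjacency tensor $\mathcal{A}(\mathcal{T})$. Moreover, $\lambda(\mathcal{T})$ is a root of $\mu(\mathcal{T},x)$ and $\lambda(\mathcal{T})=\rho(\mathcal{T})$, the spectral radius of $\mathcal{A}(\mathcal{T})$.
   Context: A $k$-graph ($k\ge2$) $\mathcal{H}$ consists of a finite vertex set $V(\mathcal{H})$ and a set $E(\mathcal{H})$ of $k$-element subsets of $V(\mathcal{H})$ (edges). A matching is a set of pairwise disjoint edges; $p(\mathcal{H},r)$ is the number of matchings with $r$ edges ($p(\mathcal{H},0)=1$). The matching polynomial is $\mu(\mathcal{H},x)=\sum_{r\ge0}(-1)^r p(\mathcal{H},r)x^{|V(\mathcal{H})|-kr}$, and $\lambda(\mathcal{H})$ denotes the maximum modulus of the zeros of $\mu(\mathcal{H},x)$. A path is an alternating sequence $(v_0,e_1,v_1,\dots,e_\ell,v_\ell)$ of distinct vertices and distinct edges with $v_{i},v_{i+1}\in e_{i+1}$; a cycle is the same but with $v_0=v_\ell$ allowed. $\mathcal{H}$ is connected if any two vertices are joined by a path, and a $k$-tree is a connected $k$-graph with no cycle. If $V(\mathcal{H})=\{v_1,\dots,v_n\}$, the adjacency tensor $\mathcal{A}(\mathcal{H})=(a_{i_1\dots i_k})$ is the order-$k$, dimension-$n$ tensor with $a_{i_1\dots i_k}=\frac{1}{(k-1)!}$ if $\{v_{i_1},\dots,v_{i_k}\}\in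 E(\mathcal{H})$ and $0$ otherwise. A number $\lambda\in\mathbb{C}$ is an eigenvalue of $\mathcal{A}$ if there is a nonzero $\mathbf{x}\in\mathbb{C}^n$ with $\sum_{i_2,\dots,i_k}a_{i i_2\dots i_k}\mathbf{x}_{i_2}\cdots\mathbf{x}_{i_k}=\lambda \mathbf{x}_i^{k-1}$ for all $i\in[n]$. The spectral radius $\rho(\mathcal{H})$ is the maximum modulus of the eigenvalues of $\mathcal{A}(\mathcal{H})$. *)

(* Defs.v *)
From HB Require Import structures.
From mathcomp Require Import all_boot all_order all_algebra.
From mathcomp Require Import reals complex.

Set Implicit Arguments.
Unset Strict Implicit.
Unset Printing Implicit Defensive.

Import Order.TTheory GRing.Theory Num.Theory.

Local Open Scope ring_scope.
Local Open Scope complex_scope.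

Record kgraph (k : nat) (V : finType) := KGraph {
  edges : {set {set V}};
  card_edge : forall e, e \in edges -> #|e| = k
}.

Section KGraph.
Context {k : nat} {V : finType}.
Implicit Types (H : kgraph k V) (u v : V) (s : seq ({set V} * V)).

(* The alternating sequence (v_0, e_1, v_1, ..., e_l, v_l) is encoded by v_0
   and s = [:: (e_1, v_1); ...; (e_l, v_l)]. *)
Fixpoint walk H u s : bool :=
  if s is (e, v) :: s' then
    [&& e \in edges H, u \in e, v \in e & walk H v s']
  else true.

Definition hpath H u s : bool :=
  [&& walk H u s, uniq (u :: unzip2 s) & uniq (unzip1 s)].

(* v_0 = v_l is the only coincidence among the vertices. Length 1 is excluded:
   otherwise (v, e, v) would make every edge e a cycle. Two distinct edges
   sharing two vertices do form a cycle (of length 2). *)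
Definition hcycle H u s : bool :=
  [&& (1 < size s)%N, walk H u s, last u (unzip2 s) == u,
      uniq (unzip2 s) & uniq (unzip1 s)].

Definition hconnected H : Prop :=
  forall u v, exists2 s, hpath H u s & last u (unzip2 s) = v.

(* The vertex set is required to be nonempty: otherwise the matching
   polynomial is 1, which has no zeros. *)
Definition ktree H : Prop :=
  [/\ (0 < #|V|)%N, hconnected H & forall u s, ~~ hcycle H u s].

Definition matching H (M : {set {set V}}) : bool :=
  (M \subset edges H) && trivIset M.

Definition num_matchings H (r : nat) : nat :=
  #|[set M : {set {set V}} | matching H M & #|M| == r]|.

(* The truncated subtraction is harmless: r disjoint edges cover k * r
   vertices, so num_matchings H r = 0 when #|V| < k * r. *)
Definition matching_poly (K : nzRingType) H : {poly K} :=
  \sum_(r < #|edges H|.+1)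
    ((-1) ^+ r * (num_matchings H r)%:R) *: 'X^(#|V| - k * r).

Definition adjacency_tensor (K : unitRingType) H (t : k.-tuple V) : K :=
  if [set v in t] \in edges H then ((k.-1)`!%:R)^-1 else 0.

(* The summation index t is the multi-index (i, i_2, ..., i_k), with first
   entry i. *)
Definition tensor_eigenvalue (K : comNzRingType) (A : k.-tuple V -> K)
    (lambda : K) : Prop :=
  exists2 x : {ffun V -> K}, x != 0 &
    forall i : V,
      \sum_(t : k.-tuple V | ohead t == Some i) A t * \prod_(j <- behead t) x j
      = lambda * x i ^+ k.-1.

End KGraph.

Arguments matching_poly {k V} K H.
Arguments adjacency_tensor {k V} K H t.

Definition is_max_modulus (R : realType) (S : R[i] -> Prop) (m : R) : Prop :=
  (exists2 z, S z & `|z| = m%:C) /\ (forall z, S z -> `|z| <= m%:C).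

Definition is_max_zero_modulus (R : realType) (k : nat) (V : finType)
    (H : kgraph k V) (m : R) : Prop :=
  is_max_modulus (fun z : R[i] => root (matching_poly R[i] H) z) m.

Definition is_spectral_radius (R : realType) (k : nat) (V : finType)
    (H : kgraph k V) (rho : R) : Prop :=
  is_max_modulus (tensor_eigenvalue (adjacency_tensor R[i] H)) rho.

(* Main.v *)
(* The matching polynomial is the value at constant weights of a multi-affine
   sum over matchings with vertex weights a, and the eigenvalue equation
   generalizes to a_v x_v^(k-1) = sum over the edges e containing v of the
   product of x over e - v. If e is a pendant edge attached at u whose leaves
   have nonzero weights with product A, then removing e and replacing a_u by
   a_u - 1/A preserves the weighted sum as well as the solvability. By induction
   on the number of edges of a hyperforest, a vanishing weighted sum yields a
   nonzero solution, so the zeros of the matching polynomial are eigenvalues.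
   Conversely let z be an eigenvalue with eigenvector x. Then y = |x| satisfies
   |z| y_v^(k-1) <= sum of products, and the same elimination, run on
   inequalities, shows that such a nonzero y cannot exist if the matching
   polynomials of all induced subhypergraphs are positive at |z|. By
   interlacing, this would follow from positivity of the matching polynomial on
   [|z|, +oo). Hence the matching polynomial is nonpositive somewhere in
   [|z|, +oo), and its largest real root dominates every eigenvalue. *)

Require Import Defs.
From mathcomp Require Import all_boot all_order all_algebra.
From mathcomp Require Import boolp reals complex polyrcf.

Set Implicit Arguments.
Unset Strict Implicit.
Unset Printing Implicit Defensive.

Import Order.TTheory GRing.Theory Num.Theory.

Local Open Scope ring_scope.
Local Open Scope complex_scope.

(** * Weighted sums over matchings and their deletion rules *)

Section WeightedMatchings.
Context {V : finType}.
Implicit Types (E M : {set {set V}}) (e f L W : {set V}) (v : V).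

(** The multivariate matching polynomial of the subhypergraph induced on [W]: edges not inside [W]
    are ignored, so [E] stays fixed while [W] shrinks. *)
Definition wmatch (K : comNzRingType) E W (a : V -> K) : K :=
  \sum_(M : {set {set V}} | [&& M \subset E, trivIset M & cover M \subset W])
    (-1) ^+ #|M| * \prod_(v in W :\: cover M) a v.

Lemma wmatch_morph (K K' : comNzRingType) (h : {rmorphism K -> K'}) E W a :
  h (wmatch E W a) = wmatch E W (h \o a).
Proof.
rewrite rmorph_sum; apply: eq_bigr => M _.
by rewrite rmorphM rmorph_sign rmorph_prod.
Qed.

Section Ring.
Context {K : comNzRingType}.
Implicit Types a b : V -> K.

Lemma eq_wmatch E W a b : {in W, a =1 b} -> wmatch E W a = wmatch E W b.
Proof.
move=> eq_ab; apply: eq_bigr => M _; congr (_ * _).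
by apply: eq_bigr => v; rewrite inE => /andP[_ /eq_ab].
Qed.

Lemma wmatch_sub E' E W a : E' \subset E ->
  {in E, forall f, f \subset W -> f \in E'} -> wmatch E W a = wmatch E' W a.
Proof.
move=> sE'E sWE'; apply: eq_bigl => M.
apply/and3P/and3P=> -[sM trM cM]; split=> //; last exact: subset_trans sE'E.
apply/subsetP=> f fM; apply: sWE'; first exact: (subsetP sM).
exact: subset_trans (bigcup_sup f fM) cM.
Qed.

Lemma wmatch_edge E W e a : e \in E -> e \subset W -> e != set0 ->
  wmatch E W a = wmatch (E :\ e) W a - wmatch (E :\ e) (W :\: e) a.
Proof.
move=> eE eW e0; rewrite /wmatch (bigID (fun M => e \in M)) /= addrC.
congr (_ + _).
  apply: eq_bigl => M; rewrite subsetD1.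
  by case: (M \subset E); case: (e \in M); rewrite ?andbF ?andbT.
(* Matchings through [e] are the [e |: M] with [M] a matching of [E :\ e] inside [W :\: e]; the
   extra edge flips the sign. *)
rewrite (reindex_onto (fun M => e |: M) (fun M => M :\ e)) /=; last first.
  by move=> M /andP[_ eM]; rewrite setD1K.
rewrite -sumrN; apply: eq_big => [M|M].
  rewrite setU11 andbT; apply/andP/and3P.
    case=> /and3P[sM trM cM] /eqP defM.
    have eM : e \notin M by rewrite -defM setD11.
    have eM1 : e \in e |: M by rewrite setU11.
    split.
    - by rewrite -defM setSD.
    - by rewrite -defM trivIsetD.
    - by rewrite -{1}defM coverD1 // setSD.
  case=> sM trM; rewrite subsetD => /andP[cM dM].
  have eM : e \notin M by move: sM; rewrite subsetD1 => /andP[].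
  split; last by rewrite setU1K.
  apply/and3P; split.
  - by rewrite subUset sub1set eE (subset_trans sM) ?subD1set.
  - apply: trivIsetU => //; last by rewrite [cover [set e]]big_set1 disjoint_sym.
    by apply/trivIsetP=> A B /set1P-> /set1P->; rewrite eqxx.
  - by rewrite /cover bigcup_setU big_set1 subUset eW.
case/andP=> /andP[/and3P[sM trM cM] _] /eqP defM.
have eM : e \notin M by rewrite -defM setD11.
rewrite cardsU1 eM exprS !mulNr mul1r; congr (- (_ * _)).
by rewrite /cover bigcup_setU big_set1 setDDl.
Qed.

Lemma wmatch_isolated E W L a : L \subset W ->
    {in E, forall f, [disjoint f & L]} ->
  wmatch E W a = \prod_(v in L) a v * wmatch E (W :\: L) a.
Proof.
move=> LW disL; rewrite /wmatch big_distrr /=.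
have dcov M : M \subset E -> [disjoint cover M & L].
  move=> sM; rewrite disjoint_sym; apply/bigcup_disjointP => f fM.
  by rewrite disjoint_sym disL // (subsetP sM).
apply: eq_big => [M|M /and3P[sM _ cM]].
  case sM: (M \subset E) => //=; case: (trivIset M) => //=.
  by rewrite subsetD dcov ?andbT.
rewrite mulrCA; congr (_ * _).
rewrite (big_setID L) /=; congr (_ * _); apply: eq_bigl => v; last first.
  by rewrite !inE; case: (v \in L); rewrite ?andbF.
rewrite !inE; case vL: (v \in L); rewrite ?andbF // (subsetP LW) // !andbT.
by rewrite (disjointFl (dcov M sM) vL).
Qed.

Lemma wmatch_set0 E a : set0 \notin E -> wmatch E set0 a = 1.
Proof.
move=> E0; rewrite /wmatch (big_pred1 set0) => [|M].
  by rewrite cards0 set0D big_set0 mulr1.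
apply/and3P/eqP => [[sM _]|->].
  rewrite subset0 => /eqP cM; apply/setP => f; rewrite [RHS]inE.
  apply/negP => fM; have : f \subset cover M by apply: bigcup_sup.
  by rewrite cM subset0 => /eqP f0; rewrite -f0 (subsetP sM) in E0.
rewrite sub0set /cover big_set0 sub0set; split=> //.
by apply/trivIsetP=> A B; rewrite inE.
Qed.

(** A matching either misses [v] or contains exactly one edge at [v]. The edges at [v] are split off
    one by one by [wmatch_edge], until [v] is isolated. *)
Lemma wmatch_vertex E W v a : set0 \notin E -> v \in W ->
  wmatch E W a =
    a v * wmatch E (W :\ v) a
    - \sum_(e in E | (v \in e) && (e \subset W)) wmatch E (W :\: e) a.
Proof.
move=> E0 vW; move: {2}#|E| (leqnn #|E|) => n; elim: n E E0 => [|n IHn] E E0 leEn.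
  move: leEn; rewrite leqn0 cards_eq0 => /eqP->.
  rewrite [X in _ - X]big1 ?subr0 => [|e]; last by rewrite inE.
  rewrite (@wmatch_isolated _ _ [set v]) ?sub1set // ?big_set1 //.
  by move=> f; rewrite inE.
case: (pickP (fun e => [&& e \in E, v \in e & e \subset W])) => [e|no_e].
  case/and3P=> eE ve eW; have e0 : e != set0 by apply: contraNneq E0 => <-.
  rewrite (wmatch_edge _ eE) // IHn; last 2 first.
  - by rewrite inE negb_and E0 orbT.
  - by rewrite -ltnS (leq_trans _ leEn) // (cardsD1 e E) eE.
  rewrite [in RHS](bigD1 e) /=; last by rewrite eE ve.
  have sub W' : v \notin W' -> wmatch E W' a = wmatch (E :\ e) W' a.
    move=> vW'; apply: wmatch_sub; first exact: subD1set.
    move=> f fE fW'; rewrite !inE fE andbT; apply: contraNneq vW' => defe.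
    by rewrite (subsetP fW') // defe.
  rewrite !sub ?inE ?eqxx ?ve // opprD addrA addrAC; congr (_ - _ - _).
  apply: eq_big => [f|f].
    by rewrite !inE; case: (f == e); rewrite ?andbF ?andbT.
  by case/andP=> _ /andP[vf _]; rewrite sub // inE vf.
rewrite [X in _ - X]big1 ?subr0 => [|e]; last by rewrite no_e.
rewrite (@wmatch_sub [set e in E | v \notin e]); last 2 first.
- by apply/subsetP=> e; rewrite inE => /andP[].
- by move=> f fE fW; move: (no_e f); rewrite inE fE fW andbT /= => ->.
rewrite (@wmatch_isolated _ _ [set v]) ?sub1set ?big_set1 //; last first.
  by move=> f; rewrite inE disjoint_sym disjoints1 => /andP[].
congr (_ * _); apply/esym/wmatch_sub.
  by apply/subsetP=> e; rewrite inE => /andP[].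
move=> f fE; rewrite inE fE => /subsetP fW.
by apply/negP => /fW; rewrite !inE eqxx.
Qed.

Lemma wmatch_weight E W v a b : set0 \notin E -> v \in W ->
    {in W :\ v, a =1 b} ->
  wmatch E W b = wmatch E W a + (b v - a v) * wmatch E (W :\ v) a.
Proof.
move=> E0 vW eq_ab; rewrite !(@wmatch_vertex E W v) //.
rewrite -(eq_wmatch _ eq_ab) [in RHS]addrAC -mulrDl (addrC (a v)) subrK.
congr (_ - _).
apply: eq_bigr => e /andP[_ /andP[ve _]]; apply: eq_wmatch => u.
rewrite inE => /andP[ue uW]; rewrite -eq_ab // !inE uW andbT.
by apply: contraNneq ue => ->.
Qed.

(* [c] stands for the inverse of the product of the leaf weights, so that the
   identity makes sense over any commutative ring. *)
Lemma wmatch_pendant E W e u a b c : set0 \notin E -> e \in E -> u \in e ->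
    e \subset W ->
    {in e :\ u & E, forall w f, w \in f -> f = e} ->
    \prod_(w in e :\ u) a w * c = 1 -> b u = a u - c ->
    {in W :\ u, a =1 b} ->
  wmatch E W a = wmatch (E :\ e) W b.
Proof.
move=> E0 eE ue eW leaf ac1 bu eq_ab.
have E0' : set0 \notin E :\ e by rewrite inE negb_and E0 orbT.
rewrite (@wmatch_weight _ _ u a b) // ?(subsetP eW) //.
rewrite (wmatch_edge _ eE) //; last by apply: contraNneq E0 => <-.
congr (_ + _).
(* Without [u], the leaves of [e] are isolated; their weights factor out and cancel against [c]. *)
rewrite bu addrC addKr (@wmatch_isolated _ (W :\ u) (e :\ u)) ?setSD //.
  rewrite mulNr mulrA (mulrC c) ac1 mul1r; congr (- wmatch _ _ _).
  by rewrite setDDl setD1K.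
move=> f; rewrite !inE => /andP[fe fE]; rewrite disjoint_sym disjoint_subset.
apply/subsetP=> w we; rewrite !inE; apply: contra fe => wf.
by rewrite (leaf w f).
Qed.

End Ring.
End WeightedMatchings.

(** * Pendant edges and the eigenvalue equation over a closed field *)

Section LeafElimination.
Context {V : finType}.
Implicit Types (E : {set {set V}}) (e f L W : {set V}) (u v w : V).

Definition pendant E e u : Prop :=
  [/\ e \in E, u \in e & {in e :\ u & E, forall w f, w \in f -> f = e}].

(** A substitute for acyclicity that passes to subsets of edges and supplies what the inductions
    need. *)
Definition leafy E : Prop :=
  forall E', E' \subset E -> E' != set0 -> exists e u, pendant E' e u.

Definition edge_sum (K : comNzRingType) E (x : V -> K) v : K :=
  \sum_(e in E | v \in e) \prod_(w in e :\ v) x w.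

Lemma edge_sum_pendant (K : comNzRingType) E e (x : V -> K) v : e \in E ->
  edge_sum E x v =
    (if v \in e then \prod_(w in e :\ v) x w else 0) + edge_sum (E :\ e) x v.
Proof.
move=> eE; rewrite /edge_sum; case: ifPn => ve.
  rewrite (bigD1 e) ?eE //=; congr (_ + _); apply: eq_bigl => f.
  by rewrite !inE; case: (f == e); rewrite ?andbF ?andbT.
rewrite add0r; apply: eq_bigl => f; rewrite !inE.
by case: eqVneq => // ->; rewrite (negbTE ve) andbF.
Qed.

Lemma eq_edge_sum (K : comNzRingType) E L (x y : V -> K) v :
    {in E, forall f, v \in f -> [disjoint f & L]} ->
    {in [predC L], x =1 y} ->
  edge_sum E x v = edge_sum E y v.
Proof.
move=> disL eq_xy; apply: eq_bigr => f /andP[fE vf]; apply: eq_bigr => w.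
rewrite inE => /andP[_ wf]; apply: eq_xy.
by rewrite inE /= (disjointFr (disL f fE vf) wf).
Qed.

Lemma pendant_disjoint E e u : pendant E e u ->
  {in E :\ e, forall f, [disjoint f & e :\ u]}.
Proof.
case=> _ _ leaf f; rewrite inE => /andP[/set1P fe fE].
rewrite disjoint_sym disjoint_subset; apply/subsetP=> w we; rewrite inE.
by apply/negP=> wf; apply/fe/(leaf w).
Qed.

Lemma leafy_sub E E' : E' \subset E -> leafy E -> leafy E'.
Proof. by move=> sE lE E'' sE''; apply: lE; apply: subset_trans sE. Qed.

Section ClosedField.
Variables (K : numClosedFieldType) (d : nat).
Hypothesis d_gt0 : (0 < d)%N.

(** Arbitrary roots have the right product up to a root of unity; correcting the value at a single
    vertex [w0] repairs it. *)
Lemma root_system L (c : V -> K) (p : K) : L != set0 ->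
    {in L, forall w, c w != 0} -> \prod_(w in L) c w = p ^+ d.+1 ->
  exists2 x : V -> K, \prod_(w in L) x w = p &
    {in L, forall w, x w ^+ d.+1 = c w}.
Proof.
case/set0Pn=> w0 w0L c0; rewrite (big_setD1 w0) //= => defp.
pose y w : K := d.+1.-root (c w); pose q := \prod_(w in L :\ w0) y w.
have yK w : y w ^+ d.+1 = c w by rewrite rootCK.
have q0 : q != 0.
  apply/prodf_neq0 => w; rewrite inE => /andP[_ wL].
  by rewrite rootC_eq0 // c0.
exists (fun w => if w == w0 then p / q else y w).
  rewrite (big_setD1 w0) //= eqxx -[RHS](divfK q0); congr (_ * _).
  by apply: eq_bigr => w; rewrite inE inE => /andP[/negbTE-> _].
move=> w wL; case: eqVneq => [->|//].
rewrite expr_div_n -defp -[q ^+ _]prodrXl; under [X in _ / X]eq_bigr do rewrite yK.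
by rewrite mulfK //; apply/prodf_neq0 => v; rewrite inE => /andP[_ /c0].
Qed.

(** Multiplying the equation at [w] by [x w] gives [a w * x w ^+ d.+1 = c * P], with [P] the product
    of [x] over [L]. The product of these over [L] leads to the choice [P = c ^+ d / A], and
    [root_system] then yields [x]. *)
Lemma pendant_solution L (a : V -> K) (c : K) : #|L| = d ->
    {in L, forall w, a w != 0} ->
  exists2 x : V -> K, \prod_(w in L) x w = c ^+ d / \prod_(w in L) a w &
    {in L, forall w, a w * x w ^+ d = c * \prod_(v in L :\ w) x v}.
Proof.
move=> cardL a0; set A := \prod_(w in L) a w.
have A0 : A != 0 by apply/prodf_neq0.
have L0 : L != set0 by rewrite -card_gt0 cardL.
have [->|c0] := eqVneq c 0.
  have d0 : (d == 0%N) = false by case: (d) d_gt0.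
  exists (fun=> 0); last by move=> w wL; rewrite expr0n d0 mulr0 mul0r.
  by rewrite expr0n d0 mul0r prodr_const cardL expr0n d0.
set P := _ / A; have P0 : P != 0 by rewrite mulf_neq0 ?invr_eq0 ?expf_neq0.
have [||x xP xK] := @root_system L (fun w => c * P / a w) P L0.
- by move=> w wL; rewrite mulf_neq0 ?(invr_eq0, a0) //; apply: mulf_neq0.
- rewrite /= prodf_div prodr_const cardL -/A exprMn exprS /P.
  by rewrite mulrAC.
have x0 : {in L, forall w, x w != 0}.
  by move/eqP: xP P0 => /eqP <- /prodf_neq0.
exists x => // w wL; apply: (mulIf (x0 w wL)).
rewrite -mulrA -exprSr xK // mulrC divfK ?a0 // -xP (big_setD1 w) //=.
by rewrite mulrCA mulrC.
Qed.


(* Remove a pendant edge [e] attached at [u]. If no leaf weight vanishes, the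
   weight of [u] is decreased and a solution extends to the leaves. If the
   leaf [w] has weight 0, then the indicator of [w] is a solution when
   [d >= 2]; when [d = 1] the equation at [w] forces [x u = 0], so delete all
   edges at [u] and use [x w] to satisfy the equation at [u]. *)
Lemma wmatch_solution E (a : V -> K) :
    {in E, forall e, #|e| = d.+1} -> leafy E -> wmatch E setT a = 0 ->
  exists2 x : V -> K, (exists v, x v != 0) &
    forall v, a v * x v ^+ d = edge_sum E x v.
Proof.
have d0 : (d == 0%N) = false by case: (d) d_gt0.
have expd0 : 0 ^+ d = 0 :> K by rewrite expr0n d0.
have nz E0 : {in E0, forall e : {set V}, #|e| = d.+1} -> set0 \notin E0.
  by move=> cE; apply/negP=> /cE; rewrite cards0.
move: {2}#|E| (leqnn #|E|) => n; elim: n E a => [|n IHn] E a leEn cardE lE.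
  move: leEn; rewrite leqn0 cards_eq0 => /eqP->.
  (* Without edges the sum is the product of all weights, so some weight vanishes. *)
  rewrite (@wmatch_isolated _ _ _ _ setT) //; last by move=> f; rewrite inE.
  rewrite setDv wmatch_set0 ?inE // mulr1 => /eqP/prodf_eq0[v _ av].
  exists (fun w => (w == v)%:R); first by exists v; rewrite eqxx oner_eq0.
  move=> w; rewrite /edge_sum [RHS]big1 => [|e]; last by rewrite inE.
  by case: eqVneq => [->|_]; rewrite ?(eqP av) ?mul0r // expd0 mulr0.
move=> mu0; have [E0|E0] := eqVneq E set0.
  by apply: (IHn E) => //; rewrite E0 cards0.
have [e [u pe]] := lE _ (subxx E) E0; have [eE ue leaf] := pe.
set L := e :\ u.
have cardL : #|L| = d by apply: succn_inj; rewrite -(cardE e eE) (cardsD1 u e) ue.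
have disL := pendant_disjoint pe.
have [w /andP[wL /eqP aw]|aL] := pickP (fun w => (w \in L) && (a w == 0)).
  have [d1|d1] := eqVneq d 1%N; last first.
    exists (fun v => (v == w)%:R); first by exists w; rewrite eqxx oner_eq0.
    move=> v; rewrite [RHS]big1 => [|f /andP[fE vf]].
      by case: eqVneq => [->|_]; rewrite ?aw ?mul0r // expd0 mulr0.
    (* Here edges have at least three vertices, so each product has a factor away from [w], where
       the indicator is 0. *)
    have: (0 < #|f :\ v :\ w|)%N.
      move: (cardE f fE) d_gt0 d1; rewrite (cardsD1 v f) vf => -[<-].
      by rewrite (cardsD1 w); case: (_ \in _); case: #|_| => [|[|m]].
    case/card_gt0P=> j; rewrite in_setD1 => /andP[/negbTE jw jf].
    by rewrite (bigD1 j) //= jw mul0r.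
  have defL : L = [set w].
    by apply/esym/eqP; rewrite eqEcard sub1set wL cards1 cardL d1.
  pose E' := [set f in E | u \notin f].
  have sE' : E' \subset E by apply/subsetP=> f; rewrite inE => /andP[].
  have eE' : e \notin E' by rewrite inE ue andbF.
  (* The vertices of [e] are isolated in [E'], so weight 1 forces the solution to vanish on them. *)
  pose a' v := if v \in e then 1 else a v.
  have mu'0 : wmatch E' setT a' = 0.
    have sub (b : V -> K) : wmatch E (setT :\: e) b = wmatch E' (setT :\: e) b.
      apply: wmatch_sub => // f fE /subsetP fe; rewrite inE fE.
      by apply/negP=> /fe; rewrite inE ue.
    rewrite (@wmatch_isolated _ _ _ _ e) ?subsetT //; last first.
      move=> f; rewrite inE => /andP[fE uf].
      rewrite disjoint_sym disjoint_subset; apply/subsetP=> v ve; rewrite inE.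
      apply: contra uf => vf; have [<-//|vu] := eqVneq v u.
      by rewrite (leaf v f) // in_setD1 vu.
    (* In the expansion at [w] the weight is 0 and only the term of [e] remains, so the sum over
       [setT :\: e] vanishes. *)
    rewrite -sub; move: mu0; rewrite (@wmatch_vertex _ _ _ _ w) ?nz // aw mul0r.
    rewrite (bigD1 e) /=; last first.
      by rewrite eE subsetT andbT; move: wL; rewrite inE => /andP[].
    rewrite big1 => [|f /andP[/and3P[fE wf _] /eqP[]]]; last exact: leaf wf.
    rewrite addr0 sub0r => /eqP; rewrite oppr_eq0 => /eqP mue.
    rewrite (@eq_wmatch _ _ _ _ _ a) ?mue ?mulr0 // => v.
    by rewrite !inE andbT /a' => /negbTE->.
  have [||||x [v0 xv0] xE] := IHn E' a' => //.
  - have /subset_leq_card : E' \subset E :\ e by rewrite subsetD1 sE' eE'.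
    by move/leq_trans; apply; rewrite -ltnS (leq_trans _ leEn) // (cardsD1 e E) eE.
  - by move=> f /(subsetP sE'); apply: cardE.
  - exact: leafy_sub lE.
  have xe v : v \in e -> x v = 0.
    move=> ve; have := xE v; rewrite /a' ve mul1r d1 expr1 => ->.
    apply: big1 => f /andP[]; rewrite inE => /andP[fE uf] vf.
    have [vu|vu] := eqVneq v u; first by rewrite -vu vf in uf.
    by rewrite (leaf v f) ?ue // in_setD1 vu in uf.
  have we : w \in e by move: wL; rewrite inE => /andP[].
  have wu : w != u by move: wL; rewrite !inE => /andP[].
  (* At [u] the left side is 0, so the product over [e :\ u], which is [y w], must cancel the other
     edges at [u]. *)
  pose y v := if v == w then - edge_sum (E :\ e) x u else x v.
  have wE f : f \in E :\ e -> [disjoint f & [set w]].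
    by move/disL; rewrite -/L defL.
  have yu : y u = 0 by rewrite /y eq_sym (negbTE wu) xe.
  have sumy v : edge_sum (E :\ e) y v = edge_sum (E :\ e) x v.
    apply: (@eq_edge_sum _ _ [set w]) => [f fE _|j]; first exact: wE.
    by rewrite !inE /y => /negbTE->.
  exists y.
    by exists v0; rewrite /y; case: (eqVneq v0 w) xv0 => [->|//]; rewrite xe ?eqxx.
  move=> v; rewrite (edge_sum_pendant _ _ eE) sumy.
  have [->|vw] := eqVneq v w.
    rewrite aw mul0r we (bigD1 u) /= ?yu ?mul0r ?add0r ?in_setD1 ?ue 1?eq_sym ?wu //.
    rewrite /edge_sum big1 // => f /andP[fE wf].
    by have := disjointFr (wE f fE) wf; rewrite inE eqxx.
  have [->|vu] := eqVneq v u.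
    by rewrite yu expd0 mulr0 ue -/L defL big_set1 /y eqxx addNr.
  have ve : v \notin e.
    by apply: contra vw => ve; rewrite -in_set1 -defL !inE vu.
  rewrite (negbTE ve) add0r /y (negbTE vw).
  have := xE v; rewrite /a' (negbTE ve) => ->.
  (* The deleted edges through [u] contribute nothing at [v], because [x u = 0]. *)
  rewrite /edge_sum [RHS](bigID (fun f => u \in f)) /= [X in X + _]big1 ?add0r.
    apply: eq_bigl => f; rewrite !inE; case: (f \in E) => //=; last first.
      by rewrite andbF.
    case vf: (v \in f); rewrite ?andbF // !andbT.
    by case: eqVneq => // fe; rewrite -fe vf in ve.
  move=> f /andP[/andP[fE vf] uf].
  by rewrite (bigD1 u) /= ?xe ?mul0r // in_setD1 uf eq_sym vu.
have {}aL : {in L, forall w, a w != 0}.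
  by move=> w wL; have := aL w; rewrite wL /= => /negbT.
pose A := \prod_(w in L) a w.
have A0 : A != 0 by apply/prodf_neq0.
pose a' v := if v == u then a u - A^-1 else a v.
have mu'0 : wmatch (E :\ e) setT a' = 0.
  rewrite -mu0; apply/esym/(@wmatch_pendant _ _ _ _ e u _ _ A^-1).
  all: rewrite ?subsetT ?divff ?/a' ?eqxx ?nz //.
  by move=> v; rewrite !inE andbT => /negbTE->.
have [||||x [v0 xv0] xE] := IHn (E :\ e) a' => //.
- by rewrite -ltnS (leq_trans _ leEn) // (cardsD1 e E) eE.
- by move=> f; rewrite inE => /andP[_]; apply: cardE.
- by apply: leafy_sub lE; rewrite subD1set.
have uL : u \notin L by rewrite !inE eqxx.
have noL v : v \in L -> edge_sum (E :\ e) x v = 0.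
  move=> vL; apply: big1 => f /andP[fE vf].
  by rewrite (disjointFr (disL f fE) vf) in vL.
(* Hence the nonzero coordinate [v0] lies outside [L] and survives when the values on [L] are
   replaced by [z]. *)
have xL v : v \in L -> x v = 0.
  move=> vL; have /eqP := xE v; rewrite noL // /a'.
  case: (eqVneq v u) vL => [->|_] vL; first by rewrite vL in uL.
  by rewrite mulf_eq0 (negbTE (aL v vL)) expf_eq0 d_gt0 => /eqP.
have [z zP zE] := pendant_solution (x u) cardL aL.
pose y v := if v \in L then z v else x v.
have yu : y u = x u by rewrite /y (negbTE uL).
have prodL (D : {set V}) : D \subset L -> \prod_(w in D) y w = \prod_(w in D) z w.
  by move=> sD; apply: eq_bigr => w /(subsetP sD); rewrite /y => ->.
exists y.
  by exists v0; rewrite /y; case: ifPn xv0 => // /xL->; rewrite eqxx.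
move=> v; rewrite (edge_sum_pendant _ _ eE).
rewrite (@eq_edge_sum _ _ L y x); first last.
- by move=> w; rewrite inE /= /y => /negbTE->.
- by move=> f fE _; apply: disL.
have [vL|vL] := boolP (v \in L).
  have /[!inE] /andP[vu ve] := vL.
  rewrite noL // ve addr0 {1}/y vL zE // [in RHS](bigD1 u) /=; last first.
    by rewrite !inE eq_sym vu ue.
  rewrite yu -prodL ?subD1set //; congr (_ * _); apply: eq_bigl => w.
  by rewrite !inE -andbA (andbC (w \in e)).
rewrite -xE /a' /y (negbTE vL); case: eqVneq vL => [-> _|vu vL].
  (* The product over the leaves is [x u ^+ d / A], exactly what lowering the weight of [u] took
     away. *)
  by rewrite ue -/y prodL // zP [X in _ + X]mulrC -mulrDr addrC subrK mulrC.
by move: vL; rewrite !inE vu /= => /negbTE->; rewrite add0r.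
Qed.

End ClosedField.
End LeafElimination.

(** * Acyclic hypergraphs have pendant edges *)

Section HyperPaths.
Context {k : nat} {V : finType}.
Implicit Types (H : kgraph k V) (u v w : V) (s : seq ({set V} * V)).

Lemma walk_cat H u s1 s2 :
  walk H u (s1 ++ s2) = walk H u s1 && walk H (last u (unzip2 s1)) s2.
Proof. by elim: s1 u => [|[e v] s1 IHs] u //=; rewrite IHs !andbA. Qed.

Lemma hpath_catl H u s1 s2 : hpath H u (s1 ++ s2) -> hpath H u s1.
Proof.
rewrite /hpath walk_cat /unzip1 /unzip2 !map_cat -cat_cons !cat_uniq.
by case/and3P=> /andP[-> _] /andP[-> _] /andP[-> _].
Qed.

Lemma hpath_close H u s g : hpath H u s -> s != [::] -> g \in edges H ->
    u \in g -> last u (unzip2 s) \in g -> g \notin unzip1 s ->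
  hcycle H (last u (unzip2 s)) ((g, u) :: s).
Proof.
move=> /and3P[ws us es] s0 gH ug lg gs; rewrite /hcycle /= gH lg ug ws eqxx gs es.
by move: us => /= ->; rewrite ltnS lt0n size_eq0 s0.
Qed.

(** Cut the path at [v], then close it with [g]. *)
Lemma hpath_close_at H u s g v : hpath H u s -> g \in edges H ->
    u \in g -> v \in g -> v \in unzip2 s -> g \notin unzip1 s ->
  exists w s', hcycle H w s'.
Proof.
move=> ps gH ug vg /mapP[p pin defv]; case/splitPr: pin ps => s1 s2 ps gs.
rewrite -cat_rcons in ps gs; have ps1 := hpath_catl ps.
have lv : last u (unzip2 (rcons s1 p)) = v by rewrite /unzip2 map_rcons last_rcons.
have gs1 : g \notin unzip1 (rcons s1 p).
  by apply: contra gs; rewrite /unzip1 map_cat mem_cat => ->.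
exists v, ((g, u) :: rcons s1 p); rewrite -{1}lv; apply: hpath_close; rewrite ?lv //.
by case: (s1).
Qed.

Section Leafy.
Variable H : kgraph k V.
Hypotheses (k_ge2 : (2 <= k)%N) (acyc : forall u s, ~~ hcycle H u s).

Let nocycle : ~ exists w s, hcycle H w s.
Proof. by case=> w [s]; apply/negP. Qed.

(* Prolong the path within [E] at its initial vertex until this is impossible:
   then the first edge is pendant. The counter [n] bounds the number of
   prolongations. *)
Lemma pendant_of_hpath (E : {set {set V}}) n u e v s :
    E \subset edges H -> (#|V| < n + size s)%N ->
    hpath H u ((e, v) :: s) -> all (mem E) (unzip1 ((e, v) :: s)) ->
  exists e u, pendant E e u.
Proof.
move=> sE; elim: n u e v s => [|n IHn] u e v s szs ps sEs.
  have /and3P[_ us _] := ps; have := max_card (mem (unzip2 s)).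
  move: us => /= /and3P[_ _ /card_uniqP->]; rewrite size_map.
  by move/(leq_trans szs); rewrite ltnn.
(* If no other edge of [E] meets [e] outside [v], then [e] is pendant at [v]. *)
have [[w f] /= /and4P[we fE wf fe]|no_f] := pickP (fun p : V * {set V} =>
    [&& p.1 \in e :\ v, p.2 \in E, p.1 \in p.2 & p.2 != e]); last first.
  have /and3P[/= /and4P[_ _ ve _] _ _] := ps.
  exists e, v; split=> //; first by have /andP[] := sEs.
  move=> w f we fE wf; apply/eqP; have := no_f (w, f).
  by rewrite /= we fE wf => /negbFE.
have /and3P[/= /and4P[eH ue ve ws] us es] := ps.
move: we; rewrite !inE => /andP[wv we].
have pvs : hpath H v s.
  by rewrite /hpath ws /=; case/andP: us => _ ->; case/andP: es.
have wns : w \notin unzip2 s.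
  apply/negP=> wins; apply/nocycle/(hpath_close_at pvs eH ve we wins).
  by case/andP: es.
(* The path now starts at [w], where [f] meets [e], so that [f] can be put in front. *)
have pw : hpath H w ((e, v) :: s).
  rewrite /hpath /= eH we ve ws es inE negb_or wv wns.
  by case/andP: us => _ /= ->.
have fH := subsetP sE f fE.
(* If [f] already occurs, the part of the path before [f] is closed by [f] into a cycle. *)
have [fs|fs] := boolP (f \in unzip1 ((e, v) :: s)).
  move: fs; rewrite /= inE (negbTE fe) => /= /mapP[[f1 x] pin /= deff1].
  case/splitPr: pin pw es => s1 s2; rewrite -cat_cons => pw es.
  have /and3P[] := pw; rewrite walk_cat => /andP[_ /= /and4P[_ lf1 _ _]] _ _.
  case: nocycle; exists (last w (unzip2 ((e, v) :: s1))), ((f, w) :: (e, v) :: s1).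
  apply: hpath_close => //; first exact: hpath_catl pw.
    by rewrite deff1.
  move: es; rewrite /= inE (negbTE fe) /unzip1 map_cat cat_uniq /= -deff1.
  by rewrite negb_or => /andP[_ /and3P[_ /andP[]]].
have /card_gt0P[x] : (0 < #|f :\ w|)%N.
  by have := card_edge fH; rewrite (cardsD1 w) wf => defk; move: k_ge2; rewrite -defk.
rewrite !inE => /andP[xw xf].
have [xs|xs] := boolP (x \in unzip2 ((e, v) :: s)).
  by case: nocycle; apply: hpath_close_at pw fH wf xf xs fs.
apply: (IHn x f w ((e, v) :: s)); first by rewrite /= addnS.
  have /and3P[ww uw ew] := pw.
  by rewrite /hpath /= fH xf wf inE negb_or xw; apply/and3P; split=> //; apply/andP.
by rewrite /= fE.
Qed.

Lemma leafy_edges : leafy (edges H).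
Proof.
move=> E sE /set0Pn[e eE]; have eH := subsetP sE e eE.
have /card_gt1P[u [v [ue ve uv]]] : (1 < #|e|)%N by rewrite (card_edge eH).
apply: (@pendant_of_hpath E #|V|.+1 u e v [::]); rewrite ?addn0 //= ?eE //.
by rewrite /hpath /= eH ue ve inE uv.
Qed.

End Leafy.
End HyperPaths.

(** * The matching polynomial as a weighted sum *)

Section MatchingPolynomial.
Context {k : nat} {V : finType}.
Variable H : kgraph k V.

Lemma card_cover_matching M : matching H M -> #|cover M| = (k * #|M|)%N.
Proof.
case/andP=> sM /eqP <-; rewrite (eq_bigr (fun=> k)) => [|e eM].
  by rewrite sum_nat_const mulnC.
exact/card_edge/(subsetP sM).
Qed.

Lemma horner_matching_poly (K : comNzRingType) (c : K) :
  (matching_poly K H).[c] = wmatch (edges H) setT (fun=> c).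
Proof.
rewrite /matching_poly horner_sum /wmatch.
(* Group the matchings by size; [inord] is faithful, as a matching has at most [#|edges H|]
   edges. *)
rewrite (partition_big (fun M : {set {set V}} => inord #|M| : 'I_#|edges H|.+1)
  predT) //=.
apply: eq_bigr => r _; rewrite hornerZ hornerXn.
have defP (M : {set {set V}}) : [&& M \subset edges H, trivIset M & cover M \subset setT] &&
    (inord #|M| == r) = (M \in [set M | matching H M & #|M| == r]).
  rewrite [RHS]inE subsetT andbT -/(matching H M) andbC [RHS]andbC.
  case mM: (matching H M); rewrite ?andbF // !andbT.
  rewrite -val_eqE /= inordK // ltnS subset_leq_card //.
  by case/andP: mM.
rewrite (eq_bigl _ _ defP) (eq_bigr (fun=> (-1) ^+ r * c ^+ (#|V| - k * r))).
  by rewrite sumr_const [LHS]mulrAC mulr_natr.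
move=> M; rewrite inE => /andP[mM /eqP cM]; rewrite cM prodr_const.
by rewrite cardsD setTI cardsT (card_cover_matching mM) cM.
Qed.

End MatchingPolynomial.

(** * The adjacency tensor in terms of edges *)

Section Tensor.
Context {V : finType} {d : nat}.
Variable H : kgraph d.+1 V.

Lemma set_cons_tuple (e : {set V}) i (t : d.-tuple V) : #|e| = d.+1 -> i \in e ->
  ([set v in i :: t] == e) = all (mem (e :\ i)) t && uniq t.
Proof.
move=> cardE ie; apply/eqP/andP => [defe|[/allP te ut]].
  have: uniq (i :: t) by apply/card_uniqP; rewrite -cardsE defe cardE /= size_tuple.
  rewrite /= => /andP[it ->]; split=> //; apply/allP => j jt.
  rewrite /= !inE -defe !inE jt orbT andbT.
  by apply: contraNneq it => <-.
have ui : uniq (i :: t).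
  by rewrite /= ut andbT; apply/negP=> /te; rewrite /= !inE eqxx.
apply/eqP; rewrite eqEcard; apply/andP; split.
  apply/subsetP=> j; rewrite !inE => /orP[/eqP-> //|/te].
  by rewrite /= inE => /andP[].
by rewrite cardsE (card_uniqP ui) /= size_tuple cardE.
Qed.

(** Each edge through [i] comes from the [d]! orderings of its other vertices, which cancels the
    factor in the tensor. *)
Lemma tensor_edge_sum (K : numFieldType) (x : V -> K) i :
  \sum_(t : d.+1.-tuple V | ohead t == Some i)
     adjacency_tensor K H t * \prod_(j <- behead t) x j
  = edge_sum (edges H) x i.
Proof.
rewrite (reindex_onto (fun t : d.-tuple V => cons_tuple i t)
  (fun t => behead_tuple t)) /=; last first.
  move=> t; case/tupleP: t => j t /= /eqP[->].
  by apply: val_inj.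
rewrite (eq_bigl predT) => [|t]; last first.
  by rewrite eqxx /=; apply/eqP/val_inj.
pose F e (t : d.-tuple V) : K := \prod_(j <- t) x j / d`!%:R.
rewrite (eq_bigr (fun t : d.-tuple V => \sum_(e in edges H | i \in e)
    if [set v in i :: t] == e then \prod_(j <- t) x j / d`!%:R else 0)).
  rewrite exchange_big; apply: eq_bigr => e /andP[eH ie].
  rewrite -big_mkcond (eq_bigl _ _ (fun t => set_cons_tuple t (card_edge eH) ie)).
  rewrite (eq_bigr (fun=> \prod_(j in e :\ i) x j / d`!%:R)) => [|t].
    rewrite sumr_const -cardsE card_uniq_tuples.
    have -> : #|mem (e :\ i)| = d.
      by apply/succn_inj; rewrite -(card_edge eH) (cardsD1 i e) ie.
    rewrite ffactnn -mulrnAr -mulr_natl divff ?mulr1 //.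
    by rewrite pnatr_eq0 -lt0n fact_gt0.
  case/andP=> /allP te ut; congr (_ / _); rewrite big_uniq //.
  apply: eq_bigl; apply/subset_cardP; last exact/subsetP.
  apply/succn_inj; rewrite (card_uniqP ut) size_tuple.
  by rewrite -(card_edge eH) (cardsD1 i e) ie.
move=> t _; rewrite /adjacency_tensor /=; case: ifPn => eH; last first.
  rewrite mul0r big1 // => e /andP[eH' _]; case: eqP => // defe.
  by rewrite defe eH' in eH.
rewrite (bigD1 [set v in i :: t]) /=; last by rewrite eH !inE eqxx.
rewrite eqxx [X in _ = _ + X]big1 ?addr0 1?mulrC // => e /andP[_]; rewrite eq_sym.
by case: eqP.
Qed.

End Tensor.

(** * Largest real roots and interlacing *)

Section RealRoots.
Variables (R : rcfType) (V : finType).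
Implicit Types (E : {set {set V}}) (W : {set V}) (p : {poly R}).

(** By the intermediate value theorem, a nonpositive value forces a root at or beyond it; take the
    largest root. *)
Lemma poly_last_root p s0 : 0 < lead_coef p -> p.[s0] <= 0 ->
  exists2 r, s0 <= r /\ root p r & forall s, r < s -> 0 < p.[s].
Proof.
move=> lp; have ivt s : p.[s] <= 0 -> exists2 r, s <= r & root p r.
  move=> ps; have [n pn] := poly_pinfty_gt_lc lp.
  have pm : 0 <= p.[Num.max n s].
    by apply/ltW/(lt_le_trans lp)/pn; rewrite le_max lexx.
  have [||r /andP[sr _] rr] := @Num.poly_ivt _ p s (Num.max n s).
  - by rewrite le_max lexx orbT.
  - by rewrite ps.
  by exists r.
case/ivt=> r0 sr0 rr0; have p0 : p != 0 by rewrite -lead_coef_eq0 gt_eqF.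
have mem_rootsR x : (x \in rootsR p) = root p x by rewrite -roots_on_rootsR // in_itv.
pose r := \big[Num.max/r0]_(x <- rootsR p) x.
have rr : root p r.
  rewrite /r big_seq; elim/big_ind: _ => //.
    by move=> x y; rewrite maxEle; case: ifP.
  by move=> x; rewrite mem_rootsR.
have lr x : root p x -> x <= r.
  by move=> rx; apply: le_bigmax_seq => //; rewrite mem_rootsR.
exists r; first by rewrite (le_trans sr0) ?lr.
move=> s rs; rewrite ltNge; apply/negP=> /ivt[x sx /lr xr].
by have := lt_le_trans rs (le_trans sx xr); rewrite ltxx.
Qed.

Definition wpoly E W : {poly R} := wmatch E W (fun=> 'X).

Lemma horner_wpoly E W s : (wpoly E W).[s] = wmatch E W (fun=> s).
Proof.
rewrite -[LHS]/(horner_eval s _) wmatch_morph; apply: eq_wmatch => v _.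
by rewrite /= /horner_eval hornerX.
Qed.

(** The empty matching gives the top power; any other covers a vertex, since edges are nonempty, and
    has smaller degree. *)
Lemma lead_coef_wpoly E W : set0 \notin E -> lead_coef (wpoly E W) = 1.
Proof.
move=> E0; rewrite /wpoly /wmatch (bigD1 set0) /=; last first.
  rewrite sub0set /cover big_set0 sub0set andbT.
  by apply/trivIsetP=> A B; rewrite inE.
rewrite cards0 mul1r prodr_const /cover big_set0 setD0.
rewrite lead_coefDl ?lead_coefXn // size_polyXn ltnS.
elim/big_ind: _ => [|p q sp sq|M /andP[/and3P[sM _ cM] M0]].
- by rewrite size_poly0.
- by rewrite (leq_trans (size_polyD _ _)) // geq_max sp.
rewrite size_Msign prodr_const size_polyXn; apply: proper_card.
have /set0Pn[f fM] := M0; have /set0Pn[v vf] : f != set0.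
  by apply: contraNneq E0 => <-; apply: (subsetP sM).
have vM : v \in cover M by apply/bigcupP; exists f.
rewrite properE subsetDl; apply/subsetPn; exists v; first exact: (subsetP cM).
by rewrite inE vM.
Qed.

(* Interlacing: at the last root [r] of the polynomial of [W :\ v], all the
   terms [- wmatch E (W :\: e)] of the expansion at [v] are nonpositive, so the
   polynomial of [W] has a root at or beyond [r]. *)
Lemma wmatch_gt0_sub E W W' (t : R) : set0 \notin E -> W' \subset W ->
    (forall s, t <= s -> 0 < wmatch E W (fun=> s)) ->
  forall s, t <= s -> 0 < wmatch E W' (fun=> s).
Proof.
move=> E0; move: {2}#|W| (leqnn #|W|) => n.
elim: n W W' t => [|n IHn] W W' t leW sW' posW.
  move: leW sW'; rewrite leqn0 cards_eq0 => /eqP W0; rewrite W0 subset0 => /eqP->.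
  by rewrite -W0.
have [/eqP eqW|] := eqVneq W' W; first by rewrite (eqP eqW).
rewrite eqEsubset sW' => /subsetPn[v vW vW'].
have leWv : (#|W :\ v| <= n)%N by move: leW; rewrite (cardsD1 v) vW.
(* By induction it suffices to remove the single vertex [v]. *)
apply: (IHn (W :\ v)) => //; first by rewrite subsetD1 sW'.
move=> s ts; rewrite ltNge -horner_wpoly; apply/negP.
have lW : 0 < lead_coef (wpoly E (W :\ v)) by rewrite lead_coef_wpoly.
case/(poly_last_root lW)=> r [sr /rootP rr] posr.
have := posW r (le_trans ts sr); rewrite (wmatch_vertex _ E0 vW).
rewrite -horner_wpoly rr mulr0 sub0r oppr_gt0 ltNge sumr_ge0 // => e.
case/and3P=> eE ve eW; rewrite leNgt -horner_wpoly; apply/negP=> neg.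
have lWe : 0 < lead_coef (wpoly E (W :\: e)) by rewrite lead_coef_wpoly.
have [r' [rr' /rootP r'0] _] := poly_last_root lWe (ltW neg).
have lt_rr' : r < r'.
  by rewrite lt_neqAle rr' andbT; apply: contraTneq neg => ->; rewrite r'0 ltxx.
(* Beyond [r] the sum of [W :\ v] is positive, so by induction that of its subset [W :\: e] is
   positive at [r'], which is a root. *)
have := IHn (W :\ v) (W :\: e) r' leWv; rewrite setDS ?sub1set //.
move=> /(_ isT) H; have := H _ r' (lexx r'); rewrite -horner_wpoly r'0 ltxx.
move=> /(_ _)/notF; apply=> x r'x; rewrite -horner_wpoly posr //.
exact: lt_le_trans r'x.
Qed.

End RealRoots.

(** * Leaf elimination for nonnegative subsolutions *)

Section Subsolutions.
Variables (R : realFieldType) (V : finType) (d : nat).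
Hypothesis d_gt0 : (0 < d)%N.
Implicit Types (E : {set {set V}}) (e W : {set V}) (u v w : V).

Lemma edge_sum_ge0 E (y : V -> R) v : (forall w, 0 <= y w) ->
  0 <= edge_sum E y v.
Proof. by move=> y0; apply: sumr_ge0 => e _; apply: prodr_ge0. Qed.

Lemma wmatch_set1 E (a : V -> R) v : {in E, forall e, #|e| = d.+1} ->
  wmatch E [set v] a = a v.
Proof.
move=> cardE; have E0 : set0 \notin E by apply/negP=> /cardE; rewrite cards0.
rewrite (@wmatch_vertex _ _ _ _ v) ?set11 // setDv wmatch_set0 // mulr1.
rewrite big1 ?subr0 // => e /and3P[eE _ /subset_leq_card].
by rewrite cards1 (cardE e eE) ltnS leqNgt d_gt0.
Qed.

(** The inequality version of [pendant_solution]: multiply the inequality at each leaf [w] by [y w],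
    take the product over the leaves and cancel [P ^+ d]; the case [P = 0] is separate. *)
Lemma pendant_prod_le E e u (a y : V -> R) : {in E, forall e, #|e| = d.+1} ->
    pendant E e u -> {in e :\ u, forall w, 0 < a w} -> (forall v, 0 <= y v) ->
    (forall v, a v * y v ^+ d <= edge_sum E y v) ->
  \prod_(w in e :\ u) y w <= y u ^+ d / \prod_(w in e :\ u) a w.
Proof.
move=> cardE pe a0 y0 suby; have [eE ue leaf] := pe.
have A0 : 0 < \prod_(w in e :\ u) a w by apply: prodr_gt0.
set P := \prod_(w in e :\ u) y w; have P0 : 0 <= P by apply: prodr_ge0.
rewrite ler_pdivlMr //; have [->|Pn0] := eqVneq P 0.
  by rewrite mul0r exprn_ge0.
have {P0} Pd : 0 < P ^+ d by rewrite exprn_gt0 // lt_neqAle eq_sym Pn0.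
rewrite -(ler_pM2r Pd) mulrAC -exprS mulrC -exprMn.
have cardL : #|e :\ u| = d.
  by apply: succn_inj; rewrite -(cardE e eE) (cardsD1 u e) ue.
rewrite -{2}cardL -prodr_const -prodrXl -big_split /=; apply: ler_prod => w we.
rewrite mulr_ge0 ?exprn_ge0 ?(ltW (a0 w we)) //= exprSr mulrA.
have /andP[wu we'] : (w != u) && (w \in e) by rewrite -in_setD1.
have -> : y u * P = edge_sum E y w * y w.
  rewrite (edge_sum_pendant _ _ eE) we' [X in _ + X]big1 ?addr0.
    by rewrite [RHS]mulrC -(big_setD1 w) // (big_setD1 u).
  move=> f /andP[fE wf]; have := disjointFr (pendant_disjoint pe fE) wf.
  by rewrite we.
by rewrite ler_wpM2r.
Qed.

Lemma subsolution_eq0 E (a y : V -> R) :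
    {in E, forall e, #|e| = d.+1} -> leafy E ->
    (forall W, 0 < wmatch E W a) -> (forall v, 0 <= y v) ->
    (forall v, a v * y v ^+ d <= edge_sum E y v) ->
  forall v, y v = 0.
Proof.
have d0 : (d == 0%N) = false by case: (d) d_gt0.
have expd0 : 0 ^+ d = 0 :> R by rewrite expr0n d0.
have le0_expr (c x : R) : 0 < c -> 0 <= x -> c * x ^+ d <= 0 -> x = 0.
  move=> c0 x0; rewrite pmulr_rle0 // => xd; apply/eqP.
  by have := eq_le (x ^+ d) 0; rewrite xd exprn_ge0 // expf_eq0 d_gt0.
move: {2}#|E| (leqnn #|E|) => n.
elim: n E a y => [|n IHn] E a y leEn cardE lE posa y0 suby v.
  apply: (le0_expr (a v)) => //; first by rewrite -(wmatch_set1 a v cardE).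
  apply: le_trans (suby v) _.
  move: leEn; rewrite leqn0 cards_eq0 => /eqP->.
  by rewrite /edge_sum big1 // => e; rewrite inE.
have E0 : set0 \notin E by apply/negP=> /cardE; rewrite cards0.
have a0 w : 0 < a w by rewrite -(wmatch_set1 a w cardE).
have [E00|Enz] := eqVneq E set0.
  by apply: (IHn E a) => //; rewrite E00 cards0.
have [e [u pe]] := lE _ (subxx E) Enz; have [eE ue leaf] := pe.
set L := e :\ u; have disL := pendant_disjoint pe.
have uL : u \notin L by rewrite !inE eqxx.
pose A := \prod_(w in L) a w; have A0 : 0 < A by apply: prodr_gt0.
pose a' w := if w == u then a u - A^-1 else a w.
(* The leaves become isolated; the value 0 keeps their inequalities valid. *)
pose y' w := if w \in L then 0 else y w.
have eq_aa' w : w != u -> a' w = a w by rewrite /a' => /negbTE->.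
have sumy w : edge_sum (E :\ e) y' w = edge_sum (E :\ e) y w.
  apply: (@eq_edge_sum _ _ _ L) => [f fE _|j]; first exact: disL.
  by rewrite inE /= /y' => /negbTE->.
have y'0 w : y' w = 0.
  apply: (IHn (E :\ e) a') => {w} [||||w|w].
  - by rewrite -ltnS (leq_trans _ leEn) // (cardsD1 e E) eE.
  - by move=> f; rewrite inE => /andP[_]; apply: cardE.
  - by apply: leafy_sub lE; rewrite subD1set.
  - move=> W; have [uW|uW] := boolP (u \in W); last first.
      rewrite (@eq_wmatch _ _ _ _ _ a) => [|w wW].
        rewrite -(@wmatch_sub _ _ (E :\ e) E) ?subD1set // => f fE fW.
        rewrite !inE fE andbT; apply: contraNneq uW => fe.
        by rewrite (subsetP fW) // fe.
      by rewrite eq_aa' //; apply: contraNneq uW => <-.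
    (* Adjoining the leaves lets [wmatch_pendant] apply; those outside [W] then factor out with
       positive weights. *)
    have := posa (W :|: L); rewrite (@wmatch_pendant _ _ E _ e u a a' A^-1) //.
    + rewrite (@wmatch_isolated _ _ _ _ (L :\: W)); last first.
        move=> f fE; rewrite disjoint_sym.
        by apply: disjointWl (subsetDl L W) _; rewrite disjoint_sym disL.
        by rewrite subDset setUA setUid subsetUr.
      have -> : (W :|: L) :\: (L :\: W) = W.
        apply/setP=> w; rewrite !inE.
        by case: (w \in W); case: (w == u); case: (w \in e).
      rewrite pmulr_rgt0 // prodr_gt0 // => w /setDP[wL _].
      by rewrite eq_aa' //; apply: contraNneq uL => <-.
    + by rewrite -(setD1K ue) subUset sub1set inE uW subsetUr.
    + by rewrite divff // gt_eqF.
    + by rewrite /a' eqxx.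
    + by move=> w; rewrite !inE => /andP[wu _]; rewrite eq_aa'.
  - by rewrite /y'; case: ifP.
  rewrite sumy; have := suby w; rewrite (edge_sum_pendant _ _ eE).
  have [wL _|wL] := boolP (w \in L).
    by rewrite /y' wL expd0 mulr0 edge_sum_ge0.
  have [->|wu] := eqVneq w u.
    rewrite /y' (negbTE uL) /a' eqxx ue mulrBl lerBlDl => /le_trans; apply.
    by rewrite lerD2r [_^-1 * _]mulrC (pendant_prod_le cardE).
  move: (wL); rewrite !inE wu /= => /negbTE->.
  by rewrite add0r eq_aa' // /y' (negbTE wL).
(* At a leaf, the only edge product contains [y u = 0], so the leaf value vanishes too. *)
have [vL|vL] := boolP (v \in L); last by have := y'0 v; rewrite /y' (negbTE vL).
have yu : y u = 0 by have := y'0 u; rewrite /y' (negbTE uL).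
apply: (le0_expr (a v)) => //; apply: le_trans (suby v) _.
have /andP[vu ve] : (v != u) && (v \in e) by rewrite -in_setD1.
rewrite (edge_sum_pendant _ _ eE) ve (bigD1 u) /=; last first.
  by rewrite in_setD1 eq_sym vu.
rewrite yu mul0r add0r /edge_sum big1 // => f /andP[fE vf].
by have := disjointFr (disL f fE) vf; rewrite vL.
Qed.

End Subsolutions.

(** * Bounding eigenvalues by the largest real root *)

Section SpectralBound.
Variables (R : realType) (V : finType) (d : nat) (E : {set {set V}}).
Hypotheses (d_gt0 : (0 < d)%N) (lE : leafy E).
Hypothesis cardE : {in E, forall e : {set V}, #|e| = d.+1}.

Let E0 : set0 \notin E.
Proof. by apply/negP=> /cardE; rewrite cards0. Qed.

(** Otherwise the sum is positive from [t] on; interlacing extends this to every [W], and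
    [subsolution_eq0] gives [y = 0]. *)
Lemma subsolution_wmatch_le0 (t : R) (y : V -> R) v : y v != 0 ->
    (forall w, 0 <= y w) -> (forall w, t * y w ^+ d <= edge_sum E y w) ->
  exists2 s, t <= s & wmatch E setT (fun=> s) <= 0.
Proof.
move=> yv y0 suby; apply: contrapT => no_s; case/eqP: yv.
apply: (subsolution_eq0 d_gt0 cardE lE _ y0 suby) => W.
apply: (wmatch_gt0_sub E0 (subsetT W)) (lexx t) => s ts.
by rewrite ltNge; apply/negP=> le0; apply: no_s; exists s.
Qed.

(** By the triangle inequality the moduli of an eigenvector form a subsolution at [|z|]. *)
Lemma eigenvalue_wmatch_le0 (z : R[i]) (x : V -> R[i]) v : x v != 0 ->
    (forall w, z * x w ^+ d = edge_sum E x w) ->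
  exists s : R, `|z| <= s%:C /\ wmatch E setT (fun=> s) <= 0.
Proof.
move=> xv xE; pose y w := complex.Re `|x w|.
have normE (c : R[i]) : `|c| = (complex.Re `|c|)%:C.
  by rewrite RRe_real // normr_real.
have [||w|s ts le0] := @subsolution_wmatch_le0 (complex.Re `|z|) y v.
- apply: contraNneq xv => yv; rewrite -normr_eq0 normE.
  by rewrite -/(y v) yv.
- by move=> w; rewrite -ler0c -normE.
- rewrite -lecR rmorphM rmorphXn /= -!normE -normrX -normrM xE.
  apply: le_trans (ler_norm_sum _ _ _) _; rewrite rmorph_sum.
  apply: ler_sum => e _; rewrite normr_prod rmorph_prod.
  by apply: ler_prod => j _; rewrite normr_ge0 /= -normE lexx.
by exists s; rewrite normE lecR.
Qed.

(** The constant 1 is a subsolution at [t = 0], so a nonpositive value occurs at some [s >= 0]; this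
    gives a nonnegative root. *)
Lemma wmatch_last_root : (0 < #|V|)%N ->
  exists lambda : R, [/\ 0 <= lambda, wmatch E setT (fun=> lambda) = 0 &
    forall s, lambda < s -> 0 < wmatch E setT (fun=> s)].
Proof.
case/card_gt0P=> v _.
have [||w|s s0] := @subsolution_wmatch_le0 0 (fun=> 1) v.
- exact: oner_neq0.
- by move=> w; apply: ler01.
- by rewrite mul0r edge_sum_ge0 // => u; apply: ler01.
rewrite -horner_wpoly => /poly_last_root[|r [sr /rootP rr] posr].
  by rewrite lead_coef_wpoly.
exists r; rewrite -horner_wpoly rr; split=> //; first exact: le_trans sr.
by move=> x /posr; rewrite horner_wpoly.
Qed.

End SpectralBound.

Theorem theorem1p3 (R : realType) (k : nat) (hk : (2 <= k)%N) (V : finType)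
    (T : kgraph k V) (hT : ktree T) :
  (forall z : R[i], root (matching_poly R[i] T) z ->
     tensor_eigenvalue (adjacency_tensor R[i] T) z) /\
  (exists lambda : R,
     [/\ is_max_zero_modulus T lambda,
         root (matching_poly R[i] T) lambda%:C &
         is_spectral_radius T lambda]).
Proof.
case: k hk T hT => [//|d] d_gt0 T [V0 _ acyc].
have lE := leafy_edges d_gt0 acyc.
have cardE : {in edges T, forall e : {set V}, #|e| = d.+1} by apply: card_edge.
have eig z : root (matching_poly R[i] T) z ->
    tensor_eigenvalue (adjacency_tensor R[i] T) z.
  rewrite /root horner_matching_poly => /eqP mu0.
  have [x [v xv] xE] := wmatch_solution d_gt0 cardE lE mu0.
  exists (finfun x).
    by apply: contraNneq xv => /ffunP/(_ v); rewrite !ffunE => ->.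
  move=> i; rewrite tensor_edge_sum ffunE xE /edge_sum.
  by apply: eq_bigr => e _; apply: eq_bigr => j _; rewrite ffunE.
have [l [l0 rl posl]] := @wmatch_last_root R V d _ d_gt0 lE cardE V0.
have rootl : root (matching_poly R[i] T) l%:C.
  rewrite /root horner_matching_poly.
  rewrite -[X in X == _]/(wmatch _ _ (real_complex R \o fun=> l)).
  by rewrite -wmatch_morph rl rmorph0.
have norml : `|l%:C| = l%:C by rewrite ger0_norm ?ler0c.
have maxl z : tensor_eigenvalue (adjacency_tensor R[i] T) z -> `|z| <= l%:C.
  case=> x x0 xE.
  have [v xv] : exists v, x v != 0.
    apply/existsP; rewrite -negb_forall; apply: contra x0 => /forallP x0.
    by apply/eqP/ffunP=> v; rewrite ffunE; apply/eqP.
  have [|s [zs le0]] := eigenvalue_wmatch_le0 d_gt0 lE cardE xv (z := z).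
    by move=> w; rewrite -xE tensor_edge_sum.
  (* A nonpositive value at [s] forces [s <= l]. *)
  apply: le_trans zs _; rewrite lecR leNgt; apply/negP=> /posl.
  by rewrite ltNge le0.
(* Zeros are eigenvalues, so the bound [maxl] serves both maxima, and [l] attains both. *)
split=> //; exists l; split=> //; split; try by exists l%:C.
- by move=> z /eig/maxl.
- by exists l%:C => //; apply: eig.
- exact: maxl.
Qed.
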